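(* Let $G$ be a metrizable topological Abelian group which is in $S_{TG}(\mathbb{T})$. Suppose that $A$ is a dense subgroup of $G$. Then $A$ is in $S_{TG}(\mathbb{T})$, too.
   Context: $\mathbb{T}$ denotes the unit circle of $\mathbb{C}$ with its usual topology and multiplication. A twisted sum of topological Abelian groups is a short exact sequence $0\to Y\stackrel{\imath}{\to} X\stackrel{\pi}{\to} Z\to 0$ of topological Abelian groups and continuous homomorphisms in which $\imath$ and $\pi$ are open onto their images. It splits if there is a continuous homomorphism $\Phi:X\to Y\times Z$ such that $\Phi\circ\imath$ is the canonical inclusion $y\mapsto (y,0)$ and $\pi_Z\circ\Phi=\pi$, where $\pi_Z:Y\times Z\to Z$ is the projection (such $\Phi$ is necessarily a topological isomorphism). A topological Abelian group $G$ belongs to $S_{TG}(\mathbb{T})$ if every twisted sum of topological Abelian groups $0\to\mathbb{T}\to X\to G\to 0$ splits. Subgroups carry the induced topology. *)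

(* Defs.v *)
From HB Require Import structures.
From mathcomp Require Import all_boot all_order all_algebra.
From mathcomp Require Import complex.
From mathcomp Require Import all_classical all_reals all_analysis.

Set Implicit Arguments.
Unset Strict Implicit.
Unset Printing Implicit Defensive.

Import Order.TTheory GRing.Theory Num.Theory.
Import numFieldNormedType.Exports.

Local Open Scope classical_set_scope.
Local Open Scope ring_scope.

(* The unit circle of the complex numbers [R[i]].  The alias [^o] is what
   carries the norm topology in the library.  A [topologicalZmodType] is written
   additively, so on [circle R] the symbols [0], [+] and [-] stand for the
   complex 1, multiplication and inverse. *)
Definition circle (R : realType) : Type :=
  set_type [set z : R[i]^o | `|z| = 1].

Section Circle.
Variable R : realType.
Local Notation T := (circle R).

HB.instance Definition _ := Topological.on T.

Lemma circle_norm (z : T) : `|val z : R[i]| = 1.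
Proof. exact: (set_valP z). Qed.

Lemma circle_unit (z : T) : (val z : R[i]) \is a GRing.unit.
Proof. by rewrite unitfE -normr_eq0 circle_norm oner_eq0. Qed.

Lemma circle1_subproof : (1 : R[i]^o) \in [set z : R[i]^o | `|z| = 1].
Proof. by apply/mem_set; rewrite /= normr1. Qed.

Lemma circleM_subproof (z w : T) :
  ((val z : R[i]) * (val w : R[i]) : R[i]^o) \in [set z : R[i]^o | `|z| = 1].
Proof. by apply/mem_set; rewrite /= normrM !circle_norm mulr1. Qed.

Lemma circleV_subproof (z : T) :
  ((val z : R[i])^-1 : R[i]^o) \in [set z : R[i]^o | `|z| = 1].
Proof. by apply/mem_set; rewrite /= normfV circle_norm invr1. Qed.

Definition circle1 : T := SigSub circle1_subproof.
Definition circleM (z w : T) : T := SigSub (circleM_subproof z w).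
Definition circleV (z : T) : T := SigSub (circleV_subproof z).

Lemma circleMA : associative circleM.
Proof. by move=> x y z; apply/val_inj; exact: mulrA. Qed.

Lemma circleMC : commutative circleM.
Proof. by move=> x y; apply/val_inj; exact: mulrC. Qed.

Lemma circle1M : left_id circle1 circleM.
Proof. by move=> x; apply/val_inj; exact: mul1r. Qed.

Lemma circleVM : left_inverse circle1 circleV circleM.
Proof. by move=> x; apply/val_inj; apply: mulVr; exact: circle_unit. Qed.

HB.instance Definition _ :=
  GRing.isZmodule.Build T circleMA circleMC circle1M circleVM.

Lemma circle_val_continuous : continuous (val : T -> R[i]^o).
Proof. exact: (@initial_continuous _ _ set_val). Qed.

Lemma circle_sub_continuous : continuous (fun x : T * T => x.1 - x.2).
Proof.
apply: (@continuous_comp_initial T (T * T)%type R[i]^o set_val).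
move=> x /=.
apply: (@cvgM R[i] _ _ _ (fun y : T * T => (val y.1 : R[i]^o))
          (fun y : T * T => (val y.2 : R[i]^o)^-1)).
  by apply: continuous_comp; [exact: cvg_fst|exact: circle_val_continuous].
apply: (@cvgV R[i]); first by rewrite -normr_eq0 circle_norm oner_eq0.
by apply: continuous_comp; [exact: cvg_snd|exact: circle_val_continuous].
Qed.

HB.instance Definition _ :=
  PreTopologicalNmodule_isTopologicalZmodule.Build T circle_sub_continuous.

End Circle.

Definition subgroup (G : topologicalZmodType) (A : zmodClosed G) : Type :=
  {x : G | x \in A}.

Section Subgroup.
Variables (G : topologicalZmodType) (A : zmodClosed G).
Local Notation S := (subgroup A).

HB.instance Definition _ := [isSub of S for @sval G (fun x => x \in A)].
HB.instance Definition _ := [Choice of S by <:].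
HB.instance Definition _ := [SubChoice_isSubZmodule of S by <:].
HB.instance Definition _ :=
  Topological.copy S (initial_topology (val : S -> G)).

Lemma subgroup_val_continuous : continuous (val : S -> G).
Proof. exact: (@initial_continuous S G val). Qed.

Lemma subgroup_sub_continuous : continuous (fun x : S * S => x.1 - x.2).
Proof.
apply: (@continuous_comp_initial S (S * S)%type G val).
move=> x.
have -> : val \o (fun y : S * S => y.1 - y.2) =
    (fun y : G * G => y.1 - y.2) \o (fun y : S * S => (val y.1, val y.2)).
  by apply/funext => y; exact: (GRing.valB y.1 y.2).
apply: continuous_comp; last exact: sub_continuous.
apply: cvg_pair => /=.
  by apply: continuous_comp; [exact: cvg_fst|exact: subgroup_val_continuous].
by apply: continuous_comp; [exact: cvg_snd|exact: subgroup_val_continuous].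
Qed.

HB.instance Definition _ :=
  PreTopologicalNmodule_isTopologicalZmodule.Build S subgroup_sub_continuous.

End Subgroup.

Definition metrizable (R : realType) (T : topologicalType) : Prop :=
  exists d : T -> T -> R,
    [/\ forall x y, d x y = 0 <-> x = y,
        forall x y, d x y = d y x,
        forall x y z, d x z <= d x y + d y z &
        forall x (U : set T),
          nbhs x U <-> exists2 e : R, 0 < e & [set y | d x y < e] `<=` U].

Definition open_onto_image (X Y : topologicalType) (f : X -> Y) : Prop :=
  forall U : set X, open U -> exists2 V : set Y, open V & f @` U = V `&` range f.

Record twisted_sum (Y X Z : topologicalZmodType)
    (i : {additive Y -> X}) (p : {additive X -> Z}) : Prop := TwistedSum {
  twisted_sum_inj : injective i;
  twisted_sum_exact : range i = [set x | p x = 0];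
  twisted_sum_surj : range p = setT;
  twisted_sum_continuous_i : continuous i;
  twisted_sum_continuous_p : continuous p;
  twisted_sum_open_i : open_onto_image i;
  twisted_sum_open_p : open_onto_image p
}.

Definition splits (Y X Z : topologicalZmodType)
    (i : {additive Y -> X}) (p : {additive X -> Z}) : Prop :=
  exists Phi : {additive X -> (Y * Z)%type},
    [/\ continuous Phi,
        forall y, Phi (i y) = (y, 0) &
        forall x, (Phi x).2 = p x].

(* [S_TG H G] says that G belongs to the class S_TG(H). *)
Definition S_TG (H G : topologicalZmodType) : Prop :=
  forall (X : topologicalZmodType)
    (i : {additive H -> X}) (p : {additive X -> G}),
    twisted_sum i p -> splits i p.

(* Main.v *)
Require Import Defs.
From HB Require Import structures.
From mathcomp Require Import all_boot all_order all_algebra.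
From mathcomp Require Import complex ring_quotient.
From mathcomp Require Import all_classical all_reals all_analysis.

(** Write H for the circle and let 0 -> H -> X -> A -> 0 be a twisted sum with
    A dense in G.  Composing with the inclusion of A turns the projection into a
    strict homomorphism f : X -> G with dense range and kernel H.  It is enough
    to find a twisted sum 0 -> H -> X' -> G -> 0 and a continuous homomorphism
    j : X -> X' that is compatible with the two copies of H: a splitting of X'
    consists of a retraction X' -> H and of the projection, and the retraction
    composed with j is a retraction X -> H, which together with the projection
    of X splits X.

    The group X' is the part of the completion of X that lies above G.  All
    groups involved have a countable base at 0 (for X this is the three-space
    property [countable_base_extension]), so sequences are enough to describe
    it.  The quotient of all sequences in X by the null sequences is a
    topological group [seq_quot X], in which the constant sequences are a copy
    of X, and X' is the subgroup of the classes of the Cauchy sequences x such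
    that f (x n) converges in G; the projection X' -> G is that limit.

    Two facts make 0 -> H -> X' -> G -> 0 a twisted sum.  The kernel is not
    enlarged ([cauchy_seq_kernel]): if x is Cauchy and f (x n) tends to 0, then x
    differs by a null sequence from a Cauchy sequence of H, and H is complete.
    The projection is onto and open ([cauchy_seq_lift]): a point of G close to 0
    is the limit of f (x n) for a Cauchy sequence x close to 0, obtained as in
    the open mapping theorem by lifting the increments of an approximating
    sequence to smaller and smaller neighborhoods.  This gives [S_TG_dense] for
    every complete Hausdorff H with a countable base at 0, in particular for the
    circle. *)

Set Implicit Arguments.
Unset Strict Implicit.
Unset Printing Implicit Defensive.

Import Order.TTheory GRing.Theory Num.Theory.
Import numFieldNormedType.Exports.

Local Open Scope classical_set_scope.
Local Open Scope ring_scope.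

(** * Neighborhoods of 0 in topological abelian groups *)

Section TopologicalGroups.
Implicit Types X Y Z : topologicalZmodType.

Lemma nbhs_translate X (x y : X) (W : set X) :
  nbhs (x + y) W -> nbhs y [set v | W (x + v)].
Proof.
have c : {for y, continuous (fun v : X => x + v)}.
  apply: (@continuous_comp _ _ _ (fun v : X => (x, v)) (fun z : X * X => z.1 + z.2)).
    by apply: cvg_pair => /=; [exact: cvg_cst|exact: cvg_id].
  exact: add_continuous.
exact: c.
Qed.

Lemma nbhs0P X (x : X) (W : set X) :
  nbhs x W <-> nbhs 0 [set v | W (x + v)].
Proof.
split=> [xW|]; first by apply: nbhs_translate; rewrite addr0.
rewrite -{1}(addNr x) => /nbhs_translate; congr nbhs.
by apply/funext => v /=; rewrite addNKr.
Qed.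

Lemma nbhs_center X (x : X) (W : set X) :
  nbhs 0 W -> nbhs x [set y | W (y - x)].
Proof.
move=> W0; apply/nbhs0P; apply: filterS W0 => v.
by rewrite /= addrAC subrr add0r.
Qed.

Lemma nbhs0_split X (U : set X) : nbhs 0 U -> exists2 V, nbhs 0 V &
  forall x y, V x -> V y -> U (x + y) /\ U (x - y).
Proof.
move=> U0.
have := @sub_continuous X (0, 0) U; rewrite /= subr0 => /(_ U0)[[P Q]/= [P0 Q0] PQU].
have := @add_continuous X (0, 0) U; rewrite /= addr0 => /(_ U0)[[P' Q']/= [P'0 Q'0] PQU'].
exists ((P `&` Q) `&` (P' `&` Q')); first by do 2![apply: filterI => //].
move=> x y [[Px _] [P'x _]] [[_ Qy] [_ Q'y]].
by split; [exact: (PQU' (x, y))|exact: (PQU (x, y))].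
Qed.

Lemma cvg_nbhs0 X (x : nat -> X) (l : X) :
  x @ \oo --> l <-> forall U, nbhs 0 U -> \forall n \near \oo, U (x n - l).
Proof.
split=> [xl U U0|xl W /nbhs0P /xl]; last first.
  by apply: filterS => n /=; rewrite subrKC.
exact: (xl (fun v => U (v - l)) (nbhs_center l U0)).
Qed.

Lemma hausdorff_nbhs0 X (x y : X) : hausdorff_space X ->
  (forall W, nbhs 0 W -> W (x - y)) -> x = y.
Proof.
move=> hX xyW; apply/esym/hX => A B /nbhs0P/xyW /= Ax Bx.
by exists x; split; [rewrite subrKC in Ax|exact: nbhs_singleton].
Qed.

Lemma additive_continuous X Y (f : {additive X -> Y}) :
  (forall V, nbhs 0 V -> exists2 U, nbhs 0 U & forall x, U x -> V (f x)) ->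
  continuous f.
Proof.
move=> f0 x W /nbhs0P /f0[U U0 UW]; apply/nbhs0P.
by apply: filterS U0 => v /UW /=; rewrite raddfD.
Qed.

Lemma nbhs0_preimage X Y (f : {additive X -> Y}) V :
  continuous f -> nbhs 0 V -> nbhs 0 (f @^-1` V).
Proof. by move=> fc V0; apply: fc; rewrite raddf0. Qed.

(** Openness onto the image only has to be tested at 0.  The right-hand side
    serves both maps of a twisted sum: for an injective map it is the continuity
    of the inverse, for a surjective one it is openness. *)
Lemma additive_open_onto_image X Y (f : {additive X -> Y}) :
  open_onto_image f <->
  forall U, nbhs 0 U -> exists2 V, nbhs 0 V &
    forall x, V (f x) -> exists2 u, U u & f u = f x.
Proof.
split=> [fo U|f0 U oU].
  rewrite nbhsE => -[B [oB B0] BU]; have [V oV fOV] := fo _ oB.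
  exists V.
    apply: open_nbhs_nbhs; split=> //.
    have [] : (V `&` range f) 0; last by [].

    by rewrite -fOV; exists 0; rewrite ?raddf0.
  move=> x Vfx; have : (V `&` range f) (f x) by split.
  by rewrite -fOV => -[u /BU ? ?]; exists u.
exists (\bigcup_(V in [set V | open V /\ V `&` range f `<=` f @` U]) V).
  by apply: bigcup_open => V [].
apply/seteqP; split=> [_ [x Ux <-]|y [[V [_ VU] Vy] fy]]; last exact: VU.
split=> //; have /nbhs0P/f0[V V0 VU] : nbhs x U by exact: open_nbhs_nbhs.
have := nbhs_center (f x) V0.
rewrite nbhsE => -[B [oB Bfx] BV]; exists B => //; split=> // y [/BV /= + [z _ zE]].
rewrite -zE; rewrite -raddfB => /VU[u Uu fu]; exists (x + u) => //.
by rewrite raddfD fu raddfB subrKC.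
Qed.

Definition countable_base X := exists U : nat -> set X,
  (forall n, nbhs 0 (U n)) /\ (forall V, nbhs 0 V -> exists n, U n `<=` V).

(** Such a base plays the role of the dyadic balls of an invariant metric; it
    comes from repeatedly halving neighborhoods. *)
Lemma countable_base_shrinking X (W : set X) : countable_base X -> nbhs 0 W ->
  exists U : nat -> set X,
  [/\ forall n, nbhs 0 (U n), U 0%N `<=` W,
      forall V, nbhs 0 V -> exists n, U n `<=` V
    & forall n x y, U n.+1 x -> U n.+1 y -> U n (x + y) /\ U n (x - y)].
Proof.
move=> [U [U0 UV]] W0.
have /choice[h hP] (V : set X) : exists V', nbhs 0 V -> nbhs 0 V' /\
    forall x y, V' x -> V' y -> V (x + y) /\ V (x - y).
  have [/nbhs0_split[V' V'0 V'V]|nV] := pselect (nbhs 0 V); last by exists V.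
  by exists V'.
pose V := fix V n := if n is m.+1 then h (V m) `&` U n else U 0%N `&` W.
have V0 n : nbhs 0 (V n).
  by elim: n => [|n IHn]/=; apply: filterI => //; case: (hP _ IHn).
exists V; split=> // [x []//|W' /UV[n UW']|n x y [hx _] [hy _]].
  by exists n; apply: subset_trans UW'; case: n => [|n] v [].
exact: (hP _ (V0 n)).2.
Qed.

Lemma shrinking_antitone X (U : nat -> set X) m n : (forall n, nbhs 0 (U n)) ->
  (forall n x y, U n.+1 x -> U n.+1 y -> U n (x + y) /\ U n (x - y)) ->
  (m <= n)%N -> U n `<=` U m.
Proof.
move=> U0 UB /subnK<-; elim: (n - m)%N => // k IHk x Ux; apply: IHk.
by rewrite -[x]addr0; apply: (UB _ _ _ _ _).1 => //; apply: nbhs_singleton.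
Qed.

(** The tail estimate of a series with terms in a shrinking base: the
    conclusion does not depend on the number of terms. *)
Lemma shrinking_sum X (U : nat -> set X) (d : nat -> X) n k :
  (forall n, nbhs 0 (U n)) ->
  (forall n x y, U n.+1 x -> U n.+1 y -> U n (x + y) /\ U n (x - y)) ->
  (forall n, U n.+1 (d n)) -> U n (\sum_(n <= j < n + k) d j).
Proof.
move=> U0 UB Ud; elim: k n => [|k IHk] n.
  by rewrite addn0 big_geq//; apply: nbhs_singleton.
rewrite addnS big_ltn ?ltnS ?leq_addr// -addSn.
exact: (UB _ _ _ (Ud n) (IHk n.+1)).1.
Qed.

Definition cauchy_seq X (x : nat -> X) := forall U, nbhs 0 U ->
  exists N, forall m n, (N <= m)%N -> (N <= n)%N -> U (x m - x n).

Definition seq_complete X := forall x : nat -> X,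
  cauchy_seq x -> exists l : X, x @ \oo --> l.

Lemma cauchy_seqB X (x y : nat -> X) :
  cauchy_seq x -> cauchy_seq y -> cauchy_seq (x - y).
Proof.
move=> cx cy U /nbhs0_split[V V0 VU].
have [N xN] := cx _ V0; have [M yM] := cy _ V0.
exists (maxn N M) => m n; rewrite !geq_max => /andP[Nm Mm] /andP[Nn Mn].
rewrite [X in U X](_ : _ = (x m - x n) - (y m - y n)); last first.
  by rewrite !opprD !opprK addrACA.
by apply: (VU _ _ _ _).2; [exact: xN|exact: yM].
Qed.

Lemma cvg_cauchy_seq X (x : nat -> X) (l : X) : x @ \oo --> l -> cauchy_seq x.
Proof.
move=> /cvg_nbhs0 xl U /nbhs0_split[V /xl[N _ NV] VU]; exists N => m n Nm Nn.
by rewrite -(subrKA l) -[l - _]opprB; apply: (VU _ _ _ _).2; apply: NV.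
Qed.

Lemma cvg_seqB X (x y : nat -> X) (k l : X) :
  x @ \oo --> k -> y @ \oo --> l -> (x - y) @ \oo --> k - l.
Proof.
move=> /cvg_nbhs0 xk /cvg_nbhs0 yl; apply/cvg_nbhs0 => U /nbhs0_split[V V0 VU].
apply: filterS2 (xk _ V0) (yl _ V0) => n xV yV.
rewrite [X in U X](_ : _ = (x n - k) - (y n - l)); first exact: (VU _ _ _ _).2.
by rewrite !opprD !opprK addrACA.
Qed.

End TopologicalGroups.

(** * Sequences modulo null sequences *)

Section SequenceQuotient.
Variable X : topologicalZmodType.

Definition null_seq : {pred nat -> X} := fun x => `[< x @ \oo --> (0 : X) >].

Lemma null_seqP (x : nat -> X) : x \in null_seq <->
  forall U, nbhs 0 U -> \forall n \near \oo, U (x n).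
Proof.
split=> [/asboolP/cvg_nbhs0 x0 U U0|x0].
  by apply: filterS (x0 _ U0) => n; rewrite subr0.
apply/asboolP/cvg_nbhs0 => U U0.
by apply: filterS (x0 _ U0) => n; rewrite subr0.
Qed.

Lemma null_seq_zmod_closed : zmod_closed null_seq.
Proof.
split=> [|x y /asboolP x0 /asboolP y0].
  by apply/null_seqP => U U0; apply: nearW => n; apply: nbhs_singleton.
by apply/asboolP; rewrite -[0 : X]subr0; exact: cvg_seqB.
Qed.

HB.instance Definition _ :=
  GRing.isZmodClosed.Build (nat -> X) null_seq null_seq_zmod_closed.

Local Notation quot := (@Quotient.quot (nat -> X) null_seq).

Definition seq_quot : Type := quot.
HB.instance Definition _ := GRing.Zmodule.on seq_quot.

Definition seq_class (x : nat -> X) : seq_quot := \pi_quot%qT x.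

Lemma seq_class_zmod_morphism : zmod_morphism seq_class.
Proof. exact: pi_is_zmod_morphism. Qed.

HB.instance Definition _ :=
  GRing.isZmodMorphism.Build (nat -> X) seq_quot seq_class seq_class_zmod_morphism.

Lemma seq_class_eq (x y : nat -> X) :
  seq_class x = seq_class y <-> (x - y) @ \oo --> (0 : X).
Proof.
split=> [/eqP|/asboolP xy].
  by rewrite /seq_class -Quotient.idealrBE => /asboolP.
by apply/eqP; rewrite /seq_class -Quotient.idealrBE.
Qed.

(** This is the quotient of the group topology on sequences in which the
    neighborhoods of 0 are given by the sequences that are eventually in U. *)
Definition seq_quot_nbhs (xi : seq_quot) : set_system seq_quot :=
  [set W | exists2 U : set X, nbhs 0 U &
    forall x, (\forall n \near \oo, U (x n)) -> W (xi + seq_class x)].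

HB.instance Definition _ := hasNbhs.Build seq_quot seq_quot_nbhs.

Lemma seq_quot_nbhs_filter (xi : seq_quot) : ProperFilter (nbhs xi).
Proof.
apply: Build_ProperFilter_ex => [W [U U0 /(_ 0) UW]|].
  exists (xi + seq_class 0); apply: UW; apply: nearW => n.
  exact: nbhs_singleton.
split; first by exists setT => //; exact: filterT.
- move=> V W [U U0 UV] [U' U'0 U'W]; exists (U `&` U'); first exact: filterI.
  move=> x xU; split; [apply: UV|apply: U'W];
  by apply: filterS xU => n [].
- by move=> V W VW [U U0 UV]; exists U => // x /UV /VW.
Qed.

Lemma seq_quot_nbhs_singleton (xi : seq_quot) (W : set seq_quot) :
  nbhs xi W -> W xi.
Proof.
move=> [U U0 /(_ 0) UW]; have := UW; rewrite raddf0 addr0; apply.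
by apply: nearW => n; exact: nbhs_singleton.
Qed.

Lemma seq_quot_nbhs_nbhs (xi : seq_quot) (W : set seq_quot) :
  nbhs xi W -> nbhs xi (nbhs^~ W).
Proof.
move=> [U /nbhs0_split[V V0 VU] UW]; exists V => // x xV.
exists V => //  y yV; rewrite -addrA -raddfD; apply: UW.
by apply: filterS2 xV yV => n Vx Vy; exact: (VU _ _ Vx Vy).1.
Qed.

HB.instance Definition _ := Nbhs_isNbhsTopological.Build seq_quot
  seq_quot_nbhs_filter seq_quot_nbhs_singleton seq_quot_nbhs_nbhs.

Lemma seq_quot_sub_continuous :
  continuous (fun z : seq_quot * seq_quot => z.1 - z.2).
Proof.
move=> [xi eta] W [U /nbhs0_split[V V0 VU] UW].
pose P (z : seq_quot) := [set t | exists2 x : nat -> X,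
  \forall n \near \oo, V (x n) & t = z + seq_class x].
have P0 z : nbhs z (P z) by exists V => // x xV; exists x.
exists (P xi, P eta) => //= -[_ _] [/= [x xV ->] [y yV ->]].
rewrite opprD addrACA -raddfB; apply: UW.
by apply: filterS2 xV yV => n Vx Vy; exact: (VU _ _ Vx Vy).2.
Qed.

HB.instance Definition _ :=
  PreTopologicalNmodule_isTopologicalZmodule.Build seq_quot
    seq_quot_sub_continuous.

Lemma seq_quot_nbhs0 (W : set seq_quot) : nbhs 0 W <->
  exists2 U : set X, nbhs 0 U &
    forall x, (\forall n \near \oo, U (x n)) -> W (seq_class x).
Proof.
by split=> -[U U0 UW]; exists U => // x /UW; rewrite add0r.
Qed.

End SequenceQuotient.

Lemma subgroup_nbhs0 (G : topologicalZmodType) (A : zmodClosed G)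
    (W : set (subgroup A)) :
  nbhs 0 W <-> exists2 V, nbhs 0 V & val @^-1` V `<=` W.
Proof.
split=> [[_ [[B oB <-] /= B0 BW]]|[V V0 VW]].
  by exists B => //; apply: open_nbhs_nbhs; split=> //; rewrite -(raddf0 val).
apply: filterS VW _; apply: subgroup_val_continuous; by rewrite raddf0.
Qed.

(** * The part of the completion of X that lies above G *)

Section ClassLimit.
Variables (X G : topologicalZmodType) (f : {additive X -> G}).
Hypotheses (hG : hausdorff_space G) (fc : continuous f).
Implicit Types (x y : nat -> X) (g h : G) (xi eta : seq_quot X).

(** The class xi is a point of the completion of X whose image under the
    extension of f to completions is g. *)
Definition class_lim xi g := exists x,
  [/\ cauchy_seq x, (f \o x) @ \oo --> g & seq_class x = xi].

Lemma class_limB xi eta g h :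
  class_lim xi g -> class_lim eta h -> class_lim (xi - eta) (g - h).
Proof.
move=> [x [cx xg <-]] [y [cy yh <-]]; exists (x - y); split.
- exact: cauchy_seqB.
- rewrite [f \o _](_ : _ = (f \o x) - (f \o y)); last first.
    by apply/funext => n /=; rewrite raddfB.
  exact: cvg_seqB.
- by rewrite raddfB.
Qed.

(** Both properties are stable under adding a null sequence, so they hold for
    every representative as soon as they hold for one. *)
Lemma class_limE xi g x : class_lim xi g -> seq_class x = xi ->
  cauchy_seq x /\ (f \o x) @ \oo --> g.
Proof.
move=> [y [cy yg <-]] /seq_class_eq xy0.
have -> : x = y - (y - x) by rewrite opprB addrCA subrr addr0.
have yx0 : (y - x) @ \oo --> (0 : X).
  by rewrite -opprB -[- _]add0r -[X in _ --> X]subr0; apply: cvg_seqB => //; exact: cvg_cst.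
split; first by apply: cauchy_seqB => //; exact: cvg_cauchy_seq yx0.
rewrite [f \o _](_ : _ = (f \o y) - (f \o (y - x))); last first.
  by apply/funext => n /=; rewrite raddfB.
rewrite -[g]subr0; apply: cvg_seqB => //; rewrite -(raddf0 f).
apply: continuous_cvg => //; exact: fc.
Qed.

Lemma class_lim_unique xi g h : class_lim xi g -> class_lim xi h -> g = h.
Proof.
move=> xg [x [cx xh xE]]; have [_ xg'] := class_limE xg xE.
exact: (cvg_unique hG xg' xh).
Qed.

Definition has_class_lim : {pred seq_quot X} :=
  fun xi => `[< exists g, class_lim xi g >].

Lemma has_class_lim_zmod_closed : zmod_closed has_class_lim.
Proof.
split=> [|xi eta /asboolP[g xg] /asboolP[h eh]]; apply/asboolP.
  exists 0, (cst 0); split; last exact: (raddf0 (@seq_class X)).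
    by apply: (@cvg_cauchy_seq _ _ 0); exact: cvg_cst.
  rewrite [f \o _](_ : _ = cst 0); first exact: cvg_cst.
  by apply/funext => n /=; rewrite raddf0.
by exists (g - h); exact: class_limB.
Qed.

HB.instance Definition _ :=
  GRing.isZmodClosed.Build (seq_quot X) has_class_lim has_class_lim_zmod_closed.

Local Notation extension := (subgroup has_class_lim).

Lemma class_lim_additive : exists p : {additive extension -> G},
  forall xi : extension, class_lim (val xi) (p xi).
Proof.
have /choice[p pP] (xi : extension) : exists g, class_lim (val xi) g.
  by apply/asboolP; exact: (valP xi).
have pB : zmod_morphism p.
  move=> xi eta; apply: class_lim_unique (pP _) _; rewrite raddfB.
  exact: class_limB (pP _) (pP _).
pose padd : {additive extension -> G} :=
  HB.pack p (GRing.isZmodMorphism.Build extension G p pB).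
by exists padd.
Qed.

Lemma class_lim_cst (x : X) : class_lim (seq_class (cst x)) (f x).
Proof.
exists (cst x); split=> //.
  by apply: (@cvg_cauchy_seq _ _ x); exact: cvg_cst.
by rewrite [f \o _](_ : _ = cst (f x))//; exact: cvg_cst.
Qed.

Lemma cst_has_class_lim (x : X) : seq_class (cst x) \in has_class_lim.
Proof. by apply/asboolP; exists (f x); exact: class_lim_cst. Qed.

Definition extension_cst (x : X) : extension :=
  exist _ (seq_class (cst x)) (cst_has_class_lim x).

Lemma extension_cst_zmod_morphism : zmod_morphism extension_cst.
Proof.
move=> x y; apply/val_inj; rewrite raddfB /= -raddfB; congr seq_class.
Qed.

HB.instance Definition _ := GRing.isZmodMorphism.Build X extension
  extension_cst extension_cst_zmod_morphism.

Lemma extension_nbhs0 (W : set extension) : nbhs 0 W <->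
  exists2 U : set X, nbhs 0 U & forall (xi : extension) x,
    seq_class x = val xi -> (\forall n \near \oo, U (x n)) -> W xi.
Proof.
split=> [/subgroup_nbhs0[V /seq_quot_nbhs0[U U0 UV] VW]|[U U0 UW]].
  by exists U => // xi x xE /UV; rewrite xE => /VW.
apply/subgroup_nbhs0; exists [set t | exists2 x : nat -> X,
    seq_class x = t & \forall n \near \oo, U (x n)].
  by apply/seq_quot_nbhs0; exists U => // x xU; exists x.
by move=> xi [x xE xU]; exact: UW xE xU.
Qed.

Lemma extension_cst_continuous : continuous extension_cst.
Proof.
apply: additive_continuous => W /extension_nbhs0[U U0 UW]; exists U => // x Ux.
by apply: (UW _ (cst x)) => //; exact: nearW.
Qed.

(** If f (x n) stays in V and tends to g, then g is the difference of a point
    of V and a point of V. *)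
Lemma class_lim_continuous (p : {additive extension -> G}) :
  (forall xi : extension, class_lim (val xi) (p xi)) -> continuous p.
Proof.
move=> pP; apply: additive_continuous => W /nbhs0_split[V V0 VW].
exists [set xi | W (p xi)] => //; apply/extension_nbhs0.
exists (f @^-1` V); first exact: nbhs0_preimage.
move=> xi x xE xV; have [_ /cvg_nbhs0/(_ V V0) xp] := class_limE (pP xi) xE.
have [n [Vx Vxp]] := @filter_ex _ _ _ _ (filterI xV xp).
by have [_] := VW _ _ Vx Vxp; rewrite /= subKr.
Qed.

End ClassLimit.

(** * Extending a twisted sum from a dense subgroup *)

(** A base at 0 of X consists of the sets where x lies in a neighborhood N
    with (N - N) small on H and f x lies in a basic neighborhood of G: if f x is
    small, then x is congruent modulo H to a small u, and x - u lies in H and in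
    N - N, hence is small as well. *)
Lemma countable_base_extension (H X G : topologicalZmodType)
    (i : {additive H -> X}) (f : {additive X -> G}) :
  injective i -> continuous i -> continuous f ->
  open_onto_image i -> open_onto_image f -> (forall x, f x = 0 -> range i x) ->
  countable_base H -> countable_base G -> countable_base X.
Proof.
move=> iI ic fc /additive_open_onto_image io /additive_open_onto_image fo kerf.
move=> [S [S0 SV]] [T [T0 TV]].
have /choice[N NP] n : exists N : set X, nbhs 0 N /\
    forall x y, N x -> N y -> forall t, i t = x - y -> S n t.
  have [M /nbhs0_split[N N0 NM] MS] := io _ (S0 n).
  exists N; split=> // x y Nx Ny t itE.
  have [|s Ss /iI<-//] := MS t; by rewrite itE; exact: (NM _ _ Nx Ny).2.
(* the base is indexed by pairs, which are encoded as natural numbers *)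
pose B k := if unpickle k is Some (n, m) then N n `&` f @^-1` (T m) else setT.
exists B; split=> [k|U /nbhs0_split[V V0 VU]].
  rewrite /B; case: unpickle => [[n m]|]; last exact: filterT.
  by apply: filterI; [exact: (NP n).1|exact: nbhs0_preimage].
have [n nV] := SV _ (nbhs0_preimage ic V0).
have [W W0 WV] := fo _ (filterI V0 (NP n).1).
have [m mW] := TV _ W0.
exists (pickle (n, m)); rewrite /B pickleK => x [Nx /mW /WV[u [Vu Nu] fu]].
have [t _ tE] : range i (x - u) by apply: kerf; rewrite raddfB fu subrr.
rewrite -[x](subrK u); apply: (VU _ _ _ Vu).1; rewrite -tE.
apply: nV; exact: ((NP n).2 x u).
Qed.

Section StrictMorphism.
Variables (H X G : topologicalZmodType).
Variables (i : {additive H -> X}) (f : {additive X -> G}).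
Hypotheses (Hhaus : hausdorff_space H) (Hcomplete : seq_complete H).
Hypotheses (Ghaus : hausdorff_space G) (Gbase : countable_base G).
Hypotheses (Xbase : countable_base X).
Hypotheses (iI : injective i) (ic : continuous i) (io : open_onto_image i).
Hypotheses (fc : continuous f) (fo : open_onto_image f) (fd : dense (range f)).
Hypothesis (if0 : range i = [set x | f x = 0]).

(** Null sequences lift along a strict map: u n is taken in the smallest U k,
    k <= n, that the openness of f allows. *)
Lemma strict_lift_null_seq (x : nat -> X) : (f \o x) @ \oo --> (0 : G) ->
  exists2 u : nat -> X, u @ \oo --> (0 : X) & forall n, f (u n) = f (x n).
Proof.
move=> /cvg_nbhs0 fx0.
have [U [U0 _ UV UB]] := countable_base_shrinking Xbase (@filterT _ (nbhs (0 : X)) _).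
have /choice[V VP] n : exists V, nbhs 0 V /\
    forall x, V (f x) -> exists2 u, U n u & f u = f x.
  by have [V V0 VU] := (additive_open_onto_image f).1 fo _ (U0 n); exists V.
have lift N n : exists u, f u = f (x n) /\
    forall k, (k <= N)%N -> V k (f (x n)) -> U k u.
  elim: N => [|N [u [fu uU]]].
    have [/(VP 0%N).2[u Uu fu]|nV] := pselect (V 0%N (f (x n))).
      by exists u; split=> // k; rewrite leqn0 => /eqP->.
    by exists (x n); split=> // k; rewrite leqn0 => /eqP->.
  have [/(VP N.+1).2[v Uv fv]|nV] := pselect (V N.+1 (f (x n))).
    by exists v; split=> // k kN _; apply: shrinking_antitone Uv.
  exists u; split=> // k; rewrite leq_eqVlt => /orP[/eqP->//|].
  exact: uU.
have /choice[u uP] n := lift n n.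
exists u => [|n]; last exact: (uP n).1.
apply/cvg_nbhs0 => W /UV[k UW].
apply: filterS2 (fx0 _ (VP k).1) (nbhs_infty_ge k) => n /=.
by rewrite !subr0 => Vk kn; apply: UW; exact: (uP n).2.
Qed.

(** The sequence x minus a lift of f (x n) to a null sequence is Cauchy and
    takes its values in H, which is complete. *)
Lemma cauchy_seq_kernel (x : nat -> X) :
  cauchy_seq x -> (f \o x) @ \oo --> (0 : G) ->
  exists t, (x - cst (i t)) @ \oo --> (0 : X).
Proof.
move=> cx /strict_lift_null_seq[u u0 fu].
have /choice[t tP] n : exists t, i t = (x - u) n.
  suff : range i ((x - u) n) by case=> t _ <-; exists t.
  by rewrite if0 /= raddfB fu subrr.
have cxu : cauchy_seq (x - u) by apply: cauchy_seqB => //; exact: cvg_cauchy_seq u0.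
have [|l tl] := Hcomplete (x := t).
  move=> W /((additive_open_onto_image i).1 io)[U /cxu[N NU] UW].
  exists N => m n Nm Nn; have [|s Ws /iI<-//] := UW (t m - t n).
  by have := NU m n Nm Nn; rewrite -(tP m) -(tP n) raddfB.
exists l; rewrite [X in X @ _](_ : _ = (i \o t - cst (i l)) - (- u)); last first.
  apply/funext => n; rewrite -[LHS]/(x n - i l).
  rewrite -[RHS]/(i (t n) - i l - - u n) tP -[(x - u) n]/(x n - u n).
  by rewrite opprK addrAC subrK.
have il : (i \o t) @ \oo --> i l by apply: continuous_cvg => //; exact: ic.
have u0' : - u @ \oo --> (0 : X).
  by rewrite -sub0r -[0 : X]subr0; apply: cvg_seqB => //; exact: cvg_cst.
rewrite -[0 : X]subr0 -{1}(subrr (i l)).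
exact: cvg_seqB (cvg_seqB il (cvg_cst _)) u0'.
Qed.

Lemma dense_range_nbhs (g : G) (W : set G) : nbhs 0 W -> exists x, W (f x - g).
Proof.
move=> /(nbhs_center g).
rewrite nbhsE => -[B [oB Bg] BW].
have [y [/BW Wy [x _ xy]]] := fd (ex_intro _ g Bg) oB.
by exists x; rewrite xy.
Qed.

(** Choose y n with f (y n) converging to g so fast that the increment
    f (y n.+1) - f (y n) lifts to some d n in U n.+1; the partial sums of d form
    the required sequence. *)
Lemma cauchy_seq_lift (W : set X) : nbhs 0 W -> exists2 V : set G, nbhs 0 V &
  forall g, V g -> exists x : nat -> X,
  [/\ cauchy_seq x, (f \o x) @ \oo --> g & forall n, W (x n)].
Proof.
move=> W0; have [U [U0 UW UV UB]] := countable_base_shrinking Xbase W0.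
have [T [T0 TV]] := Gbase.
have /choice[V VP] n : exists V : set G, [/\ nbhs 0 V, V `<=` T n &
    forall a b x, V a -> V b -> f x = a - b -> exists2 d, U n.+1 d & f d = f x].
  have [V /nbhs0_split[V' V'0 V'V] VU] :=
    (additive_open_onto_image f).1 fo _ (U0 n.+1).
  exists (V' `&` T n); split; [exact: filterI|by move=> ? []|].
  by move=> a b x [Va _] [Vb _] fx; apply: VU; rewrite fx; exact: (V'V _ _ Va Vb).2.
have V0 n : nbhs 0 (V n) by case: (VP n).
exists [set g | V 0%N (- g)].
  by apply: (@opp_continuous G 0); rewrite oppr0.
(* approximating g at stage n with all precisions V k, k <= n, avoids passing
   to a subsequence *)
move=> g Vg.
have Vbig n : nbhs 0 [set v | forall k, (k <= n)%N -> V k v].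
  elim: n => [|n IHn]; first by apply: filterS (V0 0%N) => v v0 k; rewrite leqn0 => /eqP->.
  apply: filterS2 IHn (V0 n.+1) => v vV vn k.
  by rewrite leq_eqVlt => /orP[/eqP->//|]; exact: vV.
(* starting at y 0 = 0 puts the partial sums of d, and not only their tails,
   in U 0; this start is admissible because - g belongs to V 0 *)
have /choice[y yP] n : exists y, (n = 0%N -> y = 0) /\
    forall k, (k <= n)%N -> V k (f y - g).
  case: n => [|n]; last by have [y yP] := dense_range_nbhs g (Vbig n.+1); exists y.
  by exists 0; split=> // k; rewrite leqn0 => /eqP->; rewrite raddf0 sub0r.
have /choice[d dP] n : exists d, U n.+1 d /\ f d = f (y n.+1) - f (y n).
  have [_ _ /(_ (f (y n.+1) - g) (f (y n) - g) (y n.+1 - y n))] := VP n.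
  case=> [| | |d Ud fd']; [exact: (yP n.+1).2|exact: (yP n).2| |].
    by rewrite (raddfB f) opprB subrKA.
  by exists d; rewrite fd' raddfB.
pose x n := \sum_(0 <= j < n) d j.
have xB n k : x (n + k)%N - x n = \sum_(n <= j < n + k) d j.
  by rewrite /x (big_cat_nat (n := n))//= ?leq_addr// addrAC subrr add0r.
have fx n : f (x n) = f (y n).
  elim: n => [|n IHn]; first by rewrite /x big_geq// (yP 0%N).1.
  by rewrite /x big_nat_recr//= raddfD -/(x n) IHn (dP n).2 subrKC.
have xU n k : U n (\sum_(n <= j < n + k) d j).
  exact: shrinking_sum U0 UB (fun l => (dP l).1).
exists x; split=> [W'|| n].
- move=> /nbhs0_split[S /UV[N NS] SW']; exists N => m n /subnKC<- /subnKC<-.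
  rewrite -(subrKA (x N)) -[x N - _]opprB.
  by apply: (SW' _ _ _ _).2; rewrite xB; apply: NS; exact: xU.
- apply/cvg_nbhs0 => W' /TV[k TW']; have [_ VT _] := VP k.
  apply: filterS (nbhs_infty_ge k) => n kn /=.
  by rewrite fx; apply/TW'/VT; exact: (yP n).2.
- exact/UW/(xU 0%N n).
Qed.

Theorem strict_extension_exists :
  exists (X' : topologicalZmodType) (i' : {additive H -> X'})
         (p : {additive X' -> G}) (j : {additive X -> X'}),
  [/\ twisted_sum i' p, continuous j & forall t, j (i t) = i' t].
Proof.
have [p pP] := class_lim_additive (f := f) Ghaus fc.
pose j : {additive X -> subgroup (has_class_lim f)} := extension_cst f.
pose i' : {additive H -> subgroup (has_class_lim f)} := j \o i.
exists (subgroup (has_class_lim f)), i', p, j.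
have jc : continuous j := @extension_cst_continuous _ _ f.
have fi t : f (i t) = 0.
  by have : range i (i t) by [exists t]; rewrite if0.
have pE (xi : subgroup (has_class_lim f)) g : class_lim f (val xi) g -> p xi = g.
  exact: class_lim_unique (pP _).
have liftE x g : cauchy_seq x -> (f \o x) @ \oo --> g ->
    exists2 xi : subgroup (has_class_lim f), seq_class x = val xi & p xi = g.
  move=> cx xg; have xl : class_lim f (seq_class x) g by exists x.
  have xP : seq_class x \in has_class_lim f by apply/asboolP; exists g.
  by exists (exist (fun z => z \in has_class_lim f) _ xP) => //; exact: pE.
split=> //; split.
- move=> s t /(congr1 val) /seq_class_eq /cvg_nbhs0 st.
  apply: (hausdorff_nbhs0 Hhaus) => W.
  move=> /((additive_open_onto_image i).1 io)[V /st[N _ NV] VW].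
  have [|h Wh /iI<-//] := VW (s - t).
  by have := NV N (leqnn N); rewrite /= subr0 -[_ N]/(i s - i t) raddfB.
- apply/seteqP; split=> [_ [t _ <-]|xi /= pxi].
    by rewrite /= -(fi t); apply: pE; exact: class_lim_cst.
  have [x [cx xg xE]] := pP xi; rewrite pxi in xg.
  have [t xt] := cauchy_seq_kernel cx xg.
  by exists t => //; apply/val_inj; rewrite -xE; apply/esym/seq_class_eq.
- apply/seteqP; split=> // g _.
  have [V V0 lift] := cauchy_seq_lift (@filterT _ (nbhs (0 : X)) _).
  have [|a Va] := dense_range_nbhs g (W := [set v | V (- v)]).
    by apply: (@opp_continuous G 0); rewrite oppr0.
  have [|x [cx xg _]] := lift (g - f a); first by rewrite -opprB.
  have [xi _ pxi] := liftE _ _ cx xg; exists (xi + j a) => //.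
  rewrite raddfD pxi (_ : p (j a) = f a) ?subrK//.
  by apply: pE; exact: class_lim_cst.
- by move=> t; apply: continuous_comp; [exact: ic|exact: jc].
- exact: class_lim_continuous pP.
- apply/additive_open_onto_image => W.
  move=> /((additive_open_onto_image i).1 io)[U /nbhs0_split[V V0 VU] UW].
  exists [set xi | exists2 x : nat -> X,
    seq_class x = val xi & \forall n \near \oo, V (x n)].
    by apply/extension_nbhs0; exists V => // xi x xE xV; exists x.
  move=> t [x xE xV].
  have /cvg_nbhs0/(_ V V0) txV : (cst (i t) - x) @ \oo --> (0 : X).
    by apply/seq_class_eq; rewrite xE.
  have [n [Vx Vtx]] := @filter_ex _ _ _ _ (filterI xV txV).
  have [|h Wh /iI ht] := UW t; last by exists h; rewrite // ht.
  rewrite -[i t](subrK (x n)); apply: (VU _ _ _ Vx).1.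
  by move: Vtx; rewrite /= subr0.
- apply/additive_open_onto_image => W /extension_nbhs0[U U0 UW].
  have [V V0 lift] := cauchy_seq_lift U0; exists V => // xi /lift[x [cx xg xU]].
  have [eta xE peta] := liftE _ _ cx xg; exists eta => //.
  by apply: UW xE _; exact: nearW.
Qed.

End StrictMorphism.


(** The splitting of X is x |-> ((Phi (j x)).1, p x), where Phi splits the
    extension of X to G. *)
Theorem S_TG_dense (H G : topologicalZmodType) (A : zmodClosed G) :
  hausdorff_space H -> countable_base H -> seq_complete H ->
  hausdorff_space G -> countable_base G ->
  dense [set x : G | x \in A] -> S_TG H G -> S_TG H (subgroup A).
Proof.
move=> Hhaus Hbase Hcomplete Ghaus Gbase Ad HG X i p [iI ip0 psurj ic pc io po].
pose f : {additive X -> G} := (val : {additive subgroup A -> G}) \o p.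
have fc : continuous f.
  by move=> x; apply: continuous_comp; [exact: pc|exact: subgroup_val_continuous].
have f0 x : f x = 0 -> p x = 0 by move=> fx; apply/val_inj; exact: fx.
have if0 : range i = [set x | f x = 0].
  rewrite ip0; apply/seteqP; split=> x /=; last exact: f0.
  by move=> px; rewrite /f /= px.
have fo : open_onto_image f.
  apply/additive_open_onto_image => U /((additive_open_onto_image p).1 po)[V].
  move=> /subgroup_nbhs0[W W0 WV] VU; exists W => // x /WV/VU[u Uu pu].
  by exists u; rewrite // /f /= pu.
have fd : dense (range f).
  move=> B B0 oB; have [a [Ba aA]] := Ad B B0 oB.
  have : range p (exist _ a aA) by rewrite psurj.
  by move=> [x _ xE]; exists a; split=> //; exists x; rewrite //= xE.
have Xbase : countable_base X.
  by apply: (countable_base_extension iI ic fc io fo) => // x fx; rewrite if0.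
have [X' [i' [p' [j [ts jc ji]]]]] :=
  strict_extension_exists Hhaus Hcomplete Ghaus Gbase Xbase iI ic io fc fo fd if0.
have [Phi [Phic Phii _]] := HG _ _ _ ts.
pose Psi x : H * subgroup A := ((Phi (j x)).1, p x).
have Psi_zmod : zmod_morphism Psi by move=> x y; rewrite /Psi !raddfB.
pose Psi' : {additive X -> (H * subgroup A)%type} :=
  HB.pack Psi (GRing.isZmodMorphism.Build X (H * subgroup A)%type Psi Psi_zmod).
exists Psi'; split=> //= [x|y].
  have rc : (fun x => (Phi (j x)).1) x' @[x' --> x] --> (Phi (j x)).1.
    apply: (@continuous_comp _ _ _ j (fun y => (Phi y).1)); first exact: jc.
    by apply: (@continuous_comp _ _ _ Phi fst); [exact: Phic|exact: cvg_fst].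
  exact: cvg_pair rc (pc x).
rewrite /Psi ji Phii /=; congr pair.
by have : range i (i y) by [exists y]; rewrite ip0.
Qed.

(** * The circle and metrizable spaces *)

Lemma metrizable_countable_base (R : realType) (X : topologicalZmodType) :
  metrizable R X -> countable_base X.
Proof.
move=> [d [d0 ds dt dn]].
exists (fun n => [set y | d 0 y < n.+1%:R^-1]); split=> [n|V /dn[e e0 eV]].
  by apply/dn; exists n.+1%:R^-1; rewrite // invr_gt0.
have [N _ /(_ N (leqnn N)) /= Ne] := near_infty_natSinv_lt (PosNum e0).
by exists N; apply: subset_trans eV => y /= /lt_trans; apply.
Qed.

Lemma metrizable_hausdorff (R : realType) (X : topologicalType) :
  metrizable R X -> hausdorff_space X.
Proof.
move=> [d [d0 ds dt dn]] x y xy; apply/d0.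
have dge0 a b : 0 <= d a b.
  have := dt a b a; rewrite (d0 a a).2// (ds b a) -mulr2n.
  by rewrite pmulrn_lge0.
apply/eqP; rewrite eq_le dge0 andbT; apply/ler_addgt0Pr => e e0; rewrite add0r.
have e20 : 0 < e / 2 by rewrite divr_gt0.
have [|| z [/= xz yz]] := xy [set z | d x z < e / 2] [set z | d y z < e / 2].
- by apply/dn; exists (e / 2).
- by apply/dn; exists (e / 2).
by rewrite (le_trans (dt x z y))// (ds z y) [leRHS](splitr e) lerD// ltW.
Qed.

Section CircleTopology.
Variable R : realType.
Local Notation T := (circle R).
Local Open Scope complex_scope.

Lemma circle_nbhs0 (W : set T) : nbhs 0 W <->
  exists2 e : R, 0 < e & forall z : T, `|(val z : R[i]) - 1| < e%:C -> W z.
Proof.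
split=> [[_ [[B oB <-] /= B0 BW]]|[e e0 eW]].
  have : nbhs (1 : R[i]^o) B by apply: open_nbhs_nbhs.
  move=> /nbhs_ballP[e /= e0 eB]; exists (complex.Re e).
    by move: e0; rewrite ltcE => /andP[].
  move=> z ze; apply: BW; apply: eB; rewrite /ball /= distrC.
  by move: e0 ze; case: e => a b /=; rewrite ltcE /= => /andP[/eqP-> _].
have e0C : 0 < e%:C :> R[i] by rewrite ltcR.
exists (set_val @^-1` (ball (1 : R[i]^o) e%:C)); split.
- by exists (ball (1 : R[i]^o) e%:C) => //; exact: ball_open.
- exact: (ballxx (1 : R[i]^o) e0C).
- move=> z; rewrite /preimage /= -ball_normE /= distrC; exact: eW.
Qed.

(** Rotations are isometries, so the group uniformity of the circle is that of
    the complex absolute value. *)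
Lemma circle_valB (z w : T) :
  `|(val (z - w) : R[i]) - 1| = `|(val z : R[i]) - val w|.
Proof.
rewrite -[RHS]mulr1 -[X in _ * X](circle_norm (- w)) -normrM mulrBl.
by rewrite mulfV// -normr_eq0 circle_norm oner_eq0.
Qed.

Lemma circle_countable_base : countable_base T.
Proof.
exists (fun n => [set z | `|(val z : R[i]) - 1| < (n.+1%:R^-1 : R)%:C]).
split=> [n|V /circle_nbhs0[e e0 eV]].
  by apply/circle_nbhs0; exists n.+1%:R^-1; rewrite // invr_gt0.
have [N _ /(_ N (leqnn N)) /= Ne] := near_infty_natSinv_lt (PosNum e0).
by exists N => z /= zN; apply: eV; apply: lt_trans zN _; rewrite ltcR.
Qed.

Lemma circle_hausdorff : hausdorff_space T.
Proof.
move=> x y xy; apply/val_inj.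
apply: (@norm_hausdorff _ R[i]^o) => A B Ax By.
have [z [Az Bz]] := xy _ _ (circle_val_continuous Ax) (circle_val_continuous By).
by exists (val z).
Qed.

Lemma complex_norm_le (u : R[i]) :
  `|u| <= (`|complex.Re u| + `|complex.Im u|)%:C.
Proof.
rewrite normc_def lecR -[leRHS]ger0_norm ?addr_ge0// -sqrtr_sqr.
apply: ler_wsqrtr; rewrite sqrrD !real_normK ?num_real// addrAC lerDl.
by rewrite mulrn_wge0// mulr_ge0.
Qed.

(** The real and imaginary parts converge, and the limit has absolute value 1
    because the absolute value is 1-Lipschitz. *)
Lemma circle_seq_complete : seq_complete T.
Proof.
move=> x cx.
have cRe (h : R[i] -> R) : (forall z, `|h z|%:C <= `|z|) ->
    (forall z w, h (z - w) = h z - h w) -> exists a : R,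
    forall e : R, 0 < e -> \forall n \near \oo, `|h (val (x n)) - a| < e.
  move=> hle hB.
  have : cvg ((fun n => h (val (x n))) @ \oo).
    apply: cauchy_cvg; apply: cauchy_exP => e /= e0.
    have [|N xN] := cx [set z | `|(val z : R[i]) - 1| < e%:C].
      by apply/circle_nbhs0; exists e.
    exists (h (val (x N))); exists N => // n /= Nn; rewrite /ball /= -hB.
    by rewrite -ltcR (le_lt_trans (hle _))// -circle_valB; exact: xN.
  move=> /cvgrPdist_lt xa; exists (lim ((fun n => h (val (x n))) @ \oo)) => e /xa.
  by apply: filterS => n; rewrite distrC.
have [|z w|a xa] := cRe (@complex.Re R); first exact: normc_ge_Re.
  by rewrite raddfB.
have [|z w|b xb] := cRe (@complex.Im R).
- move=> z; rewrite normc_def lecR -sqrtr_sqr ler_sqrt ?lerDr ?sqr_ge0//.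
  by rewrite addr_ge0// sqr_ge0.
- by rewrite raddfB.
pose z : R[i] := a +i* b.
have xz (e : R) : 0 < e -> \forall n \near \oo, `|(val (x n) : R[i]) - z| < e%:C.
  move=> e0; have e20 : 0 < e / 2 by rewrite divr_gt0.
  apply: filterS2 (xa _ e20) (xb _ e20) => n na nb.
  rewrite (le_lt_trans (complex_norm_le _))// ltcR [ltRHS](splitr e).
  by rewrite !raddfB ltrD.
have z1 : `|z| = 1.
  have ze (e : R) : 0 < e -> `|1 - `|z| | < e%:C.
    move=> /xz/filter_ex[n]; apply: le_lt_trans.
    by have := ler_dist_dist (val (x n) : R[i]) z; rewrite circle_norm.
  apply/eqP; rewrite eq_sym -subr_eq0 -normr_eq0; apply: contraT => nz.
  have /RRe_real dE : `|1 - `|z| | \is Num.real by exact: normr_real.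
  have := ze (complex.Re `|1 - `|z| |); rewrite dE ltxx; apply.
  by rewrite -ltcR dE normr_gt0 -normr_eq0.
exists (SigSub (mem_set z1) : T); apply/cvg_nbhs0 => W /circle_nbhs0[e e0 eW].
by apply: filterS (xz _ e0) => n nz; apply: eW; rewrite circle_valB.
Qed.
End CircleTopology.

Theorem proposition2p13 (R : realType) (G : topologicalZmodType)
    (A : zmodClosed G) :
  metrizable R G ->
  S_TG (circle R) G ->
  dense [set x : G | x \in A] ->
  S_TG (circle R) (subgroup A).
Proof.
move=> Gmet GS Ad; apply: S_TG_dense => //.
- exact: circle_hausdorff.
- exact: circle_countable_base.
- exact: circle_seq_complete.
- exact: metrizable_hausdorff Gmet.
- exact: metrizable_countable_base Gmet.
Qed.
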